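(* Let $S$ be an idempotent groupoid with a right identity element $r\in S$, and let $T$ be a distributive groupoid. Then $[S]\cong[T]$ if and only if $S\cong T$.
   Context: A groupoid is a set with a binary operation, written as juxtaposition. It is idempotent if $xx=x$ for all $x$. A right identity is an element $r$ with $xr=x$ for all $x$. A groupoid is distributive if it is both right distributive, $(xy)z=(xz)(yz)$, and left distributive, $x(yz)=(xy)(xz)$, for all $x,y,z$. For a groupoid $S$, $[S]$ denotes the set $S$ with its natural ternary operation $[abc]=(ab)c$. $[S]\cong[T]$ means that there is a bijection $\delta:S\to T$ with $\delta[abc]=[(\delta a)(\delta b)(\delta c)]$ for all $a,b,c\in S$. *)

(* Defs.v *)
From mathcomp Require Import ssreflect ssrfun monoid.
Set Implicit Arguments.
Unset Strict Implicit.
Unset Printing Implicit Defensive.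

Local Open Scope group_scope.

(* A groupoid in the sense of universal algebra is a [magmaType]. *)

(* [left_distributive] of ssrfun is (x * y) * z = (x * z) * (y * z), which is
   called right distributivity in the theory of groupoids, and conversely. *)
Definition distributive_magma (S : magmaType) : Prop :=
  left_distributive (@mul S) (@mul S) /\ right_distributive (@mul S) (@mul S).

Definition ternary (S : magmaType) (a b c : S) : S := (a * b) * c.

Definition magma_isomorphic (S T : magmaType) : Prop :=
  exists f : {multiplicative S -> T}, bijective f.

Definition ternary_isomorphic (S T : magmaType) : Prop :=
  exists2 f : S -> T, bijective f &
    forall a b c, f (ternary a b c) = ternary (f a) (f b) (f c).

(* Main.v *)
Require Import Defs.
From HB Require Import structures.
From mathcomp Require Import ssreflect ssrfun monoid.

(* Every ternary isomorphism f is already multiplicative.  Put e = f r.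
   Evaluating the ternary product with r in the various slots shows that
   x |-> x e is an involution of T with x x = x e and x (y e) = x y, and
   f (a b) = (f a f b) e.  Left distributivity, x (x x) = (x x) (x x), then
   reads x e = x, so e is a right identity of T. *)

Local Open Scope group_scope.

Lemma distributive_right_id (T : magmaType) (e : T) :
    distributive_magma T ->
    (forall x : T, (x * e) * e = x) ->
    (forall x : T, (x * x) * e = x) ->
    (forall x y : T, (x * e) * y = (x * y) * e) ->
  right_id e (@mul T).
Proof.
move=> [rdistr ldistr] ee xxe xey x.
have xx y : y * y = y * e by rewrite -[LHS]ee xxe.
have xye y z : y * (z * e) = y * z.
  (* Writing [y] as [(y * e) * e] lets right distributivity pull out the factor [e]. *)
  by rewrite -{1}(ee y) -rdistr -xey ee.
(* The chain is x e = x x = x (x e) = x (x x) = (x x) (x x) = (x x) e = x. *)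
by rewrite -[LHS]xx -xye -[x * e]xx ldistr xx xxe.
Qed.

Lemma ternary_morph_mul (S : magmaType) (r : S) (T : magmaType) (f : S -> T) :
    idempotent_op (@mul S) -> right_id r (@mul S) -> distributive_magma T ->
    bijective f ->
    (forall a b c, f (ternary a b c) = ternary (f a) (f b) (f c)) ->
  {morph f : a b / a * b}.
Proof.
rewrite /ternary => idemS rightidS distrT [g _ gK] fM.
(* Here [r] fills the last slot of the ternary product; for [fMl], the middle one. *)
have fMr a b : f (a * b) = f a * f b * f r by rewrite -fM rightidS.
have fMl a b : f (a * b) = f a * f r * f b by rewrite -fM rightidS.
have f_r_id : right_id (f r) (@mul T).
  (* Since [f] is onto, the three identities may be checked on images: they come from x r = x, from
     x x = x, and from comparing [fMl] with [fMr]. *)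
  apply: distributive_right_id distrT _ _ _ => [x | x | x y].
  - by rewrite -(gK x) -fMr rightidS.
  - by rewrite -(gK x) -fMr idemS.
  - by rewrite -(gK x) -(gK y) -fMl fMr.
by move=> a b; rewrite fMr f_r_id.
Qed.

Theorem corollary17 (S : magmaType) (r : S) (T : magmaType)
  (idemS : idempotent_op (@mul S)) (rightidS : right_id r (@mul S))
  (distrT : distributive_magma T) :
  ternary_isomorphic S T <-> magma_isomorphic S T.
Proof.
split=> [[f bij_f fM] | [f bij_f]].
  have f_mul := @ternary_morph_mul S r T f idemS rightidS distrT bij_f fM.
  pose f_mult := isMultiplicative.Build S T f f_mul.
  pose F : {multiplicative S -> T} := HB.pack f f_mult.
  by exists F.
by exists f => // a b c; rewrite /ternary !gmulfM.
Qed.
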